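(* Let $A$ be an unrooted directed tree, let $1\le p<\infty$, and let $\lambda=(\lambda_v)_{v\in A}$ be a weight such that the induced weighted backward shift $B_\lambda:\ell^p(A)\to\ell^p(A)$ is bounded. Suppose that there is a sequence of non-negative integers $(n_k)_{k\ge1}$ such that, for every $v\in A$, $$\sup_{u\in\mathrm{Chi}^{n_k}(v)}|\lambda(v\to u)|\xrightarrow{k\to+\infty}+\infty\quad\text{and}\quad\lambda(\mathrm{par}^{n_k}(v)\to v)\xrightarrow{k\to+\infty}0.$$ Then $B_\lambda$ has a dense, countably generated, free hypercyclic algebra.
   Context: All scalars are complex. A directed tree is a connected directed graph $(A,E)$ with countable vertex set $A$ and edge set $E\subset\{(a,b)\in A\times A: a\ne b\}$, having no cycles, and such that each vertex $b$ has at most one parent, i.e. a vertex $a=\mathrm{par}(b)$ with $(a,b)\in E$. The tree is unrooted if every vertex has a parent. $\mathrm{par}^0(b)=b$ and $\mathrm{par}^k(b)=\mathrm{par}(\mathrm{par}^{k-1}(b))$. $\mathrm{Chi}(v)$ is the set of children of $v$ (vertices whose parent is $v$), $\mathrm{Chi}^0(v)=\{v\}$, $\mathrm{Chi}^n(v)=\bigcup_{u\in\mathrm{Chi}^{n-1}(v)}\mathrm{Chi}(u)$. All trees are assumed leafless: every vertex has at least one child (possibly infinitely many). A weight is a family $\lambda=(\lambda_v)_{v\in A}$ of non-zero scalars. The weighted backward shift is $(B_\lambda f)(v)=\sum_{u\in\mathrm{Chi}(v)}\lambda_uf(u)$ for $f\in\mathbb{C}^A$, $v\in A$. For $u\in\mathrm{Chi}^n(v)$,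 $n\ge0$, put $\lambda(v\to u)=\prod_{k=0}^{n-1}\lambda_{\mathrm{par}^k(u)}$ (equal to $1$ if $n=0$). $\ell^p(A)$ is the space of $f\in\mathbb{C}^A$ with $\|f\|_p=(\sum_{v\in A}|f(v)|^p)^{1/p}<\infty$; it is a Banach algebra for the coordinatewise product $(fg)(v)=f(v)g(v)$. $HC(T)$ is the set of hypercyclic vectors of $T$, i.e. vectors $x$ whose orbit $\{T^nx:n\ge0\}$ is dense. A hypercyclic algebra for $T$ is a subalgebra, not $\{0\}$, contained in $HC(T)\cup\{0\}$. It is dense if it is dense in the whole space, and countably generated and free if it is generated by a countably infinite set $G$ that is algebraically independent: $P(g_1,\dots,g_d)\ne0$ for all $d\geq 1$, distinct $g_1,\dots,g_d\in G$ and every non-zero polynomial $P$ in $d$ commuting variables without constant term. *)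

(* Defs.v *)
From HB Require Import structures.
From mathcomp Require Import all_boot all_order all_algebra.
From mathcomp Require Import all_classical all_reals all_analysis.
From mathcomp Require Import complex.
From mathcomp Require mpoly.
Set Implicit Arguments.
Unset Strict Implicit.
Unset Printing Implicit Defensive.
Import Order.TTheory GRing.Theory Num.Theory.
Import numFieldNormedType.Exports.
(* The notations of mpoly clash with those of the analysis library. *)
Import -(notations) mpoly.
Export ComplexField.Normc(normc).
Local Open Scope classical_set_scope.
Local Open Scope complex_scope.
Local Open Scope ring_scope.

Section Trees.
Variables (A : countType) (E : rel A).

(* E a b means that (a, b) is an edge, i.e. that a is a parent of b. *)
Record directed_tree : Prop := DirectedTree {
  tree_nonempty : [set: A] !=set0;
  tree_loopless : irreflexive E;
  tree_connected : forall a b : A, exists2 s : seq A,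
    path (fun x y => E x y || E y x) a s & last a s = b;
  tree_acyclic : forall s : seq A, ucycle E s -> s = [::];
  tree_parent : forall a a' b : A, E a b -> E a' b -> a = a' }.

Definition unrooted : Prop := forall b : A, exists a : A, E a b.

Definition leafless : Prop := forall a : A, exists b : A, E a b.

(* The value is b itself when b has no parent. *)
Definition par (b : A) : A := xget b [set a | E a b].

Definition Chi (v : A) : set A := [set u | E v u].

Fixpoint Chin (n : nat) (v : A) : set A :=
  if n is m.+1 then \bigcup_(u in Chin m v) Chi u else [set v].

End Trees.

Section Spaces.
Variables (R : realType) (A : countType).
Implicit Types (f g : A -> R[i]) (p : R).

(* Sum of an absolutely summable complex family, through the positive and
   negative parts of its real and imaginary parts. It is meaningful only under
   csummable; absolute and unconditional summability agree in R[i]. *)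
Definition csum (D : set A) f : R[i] :=
  let rsum (x : A -> \bar R) : R := fine (esum D x^\+ - esum D x^\-)%E in
  rsum (fun v => (complex.Re (f v))%:E) +i* rsum (fun v => (complex.Im (f v))%:E).

Definition csummable (D : set A) f : Prop :=
  summable D (fun v => (normc (f v))%:E).

Definition lpnorm p f : \bar R :=
  ((\esum_(v in [set: A]) (normc (f v) `^ p)%:E) `^ p^-1)%E.

Definition lp p : set (A -> R[i]) := [set f | (lpnorm p f < +oo)%E].

Definition lp_dense p (S : set (A -> R[i])) : Prop :=
  forall f, lp p f -> forall e : R, 0 < e ->
  exists2 g, S g & (lpnorm p (f - g)%R < e%:E)%E.

Variables (E : rel A) (lam : A -> R[i]).

Definition Bshift f : A -> R[i] :=
  fun v => csum (Chi E v) (fun u => lam u * f u).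

(* Besides boundedness, the defining series converge on the whole of l^p; the
   bound implies that l^p is mapped into itself. *)
Definition Bshift_bounded p : Prop :=
  (forall f, lp p f -> forall v, csummable (Chi E v) (fun u => lam u * f u)) /\
  exists M : R, forall f, lp p f ->
    (lpnorm p (Bshift f) <= M%:E * lpnorm p f)%E.

(* lambda(v -> u) for u in Chi^n(v); it depends on n and u only, since then
   v = par^n(u). In particular path_weight n v = lambda(par^n(v) -> v). *)
Definition path_weight (n : nat) (u : A) : R[i] :=
  \prod_(k < n) lam (iter k (par E) u).

End Spaces.

Section Algebras.
Variables (R : realType) (A : countType) (p : R).
Implicit Types (f g : A -> R[i]) (S G : set (A -> R[i])).

Definition HC (T : (A -> R[i]) -> (A -> R[i])) : set (A -> R[i]) :=
  [set f | lp p f /\ lp_dense p [set iter n T f | n in [set: nat]]].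

Record subalgebra S : Prop := Subalgebra {
  subalgebra_lp : S `<=` lp p;
  subalgebra0 : S 0;
  subalgebraD : forall f g, S f -> S g -> S (f + g);
  subalgebraZ : forall (c : R[i]) f, S f -> S (fun v => c * f v);
  subalgebraM : forall f g, S f -> S g -> S (f * g) }.

Definition hypercyclic_algebra (T : (A -> R[i]) -> (A -> R[i])) S : Prop :=
  [/\ subalgebra S, S <> [set 0] & S `<=` HC T `|` [set 0]].

(* The product being coordinatewise, P(g_1, ..., g_d) is computed at each
   vertex. *)
Definition peval (d : nat) (P : mpoly d R[i]) (g : 'I_d -> A -> R[i]) :
    A -> R[i] :=
  fun v => meval (fun i => g i v) P.

Definition algebraically_independent G : Prop :=
  forall (d : nat) (g : 'I_d -> A -> R[i]) (P : mpoly d R[i]),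
    (0 < d)%N -> injective g -> (forall i, G (g i)) ->
    P != 0 -> mcoeff mnm0 P = 0 -> peval P g <> 0.

Definition countably_generated_free S : Prop :=
  exists G : set (A -> R[i]),
    [/\ G `<=` lp p, countable G, infinite_set G,
        algebraically_independent G & S = smallest subalgebra G].

End Algebras.

(* Main.v *)
Require Import Defs.
From mathcomp Require Import all_boot all_order all_algebra.
From mathcomp Require Import all_classical all_reals all_analysis.
From mathcomp Require Import complex ring lra.
From mathcomp Require mpoly.
Set Implicit Arguments.
Unset Strict Implicit.
Unset Printing Implicit Defensive.
Import Order.TTheory GRing.Theory Num.Theory.
Import numFieldNormedType.Exports.
Import -(notations) mpoly.
Local Open Scope classical_set_scope.
Local Open Scope complex_scope.
Local Open Scope ring_scope.

(** The generators g_0, g_1, ... of the algebra are assembled from blocks with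
    pairwise disjoint finite supports. Since the product is coordinatewise, a
    polynomial without constant term acts on every block separately, and it is
    enough to understand one block.

    Block k belongs to a triple (N, W, y), where y has finite support. Choose
    a power n of the shift B and, for every v in the support of y, a
    descendant u of v of generation n whose weight w = lambda(v -> u) is huge.
    Put at u an auxiliary number t with t^W = y(v) / w, and let g_i take the
    value t^(N^i) at u. A monomial with exponents m_j in the generators of
    indices s_j takes at u the value t^e with e = sum_j m_j N^(s_j). The power
    B^n moves u to v and multiplies by w: the result is exactly y(v) if e = W,
    and y(v) t^(e - W) if e > W, which is negligible because t is tiny. For
    large N, uniqueness of the base-N expansion keeps the exponents of the
    finitely many monomials of P distinct. If W is the least of them, then B^n
    sends the block to nearly c y, where c is the coefficient of the monomial
    of exponent W (least_monomial, peval_gen_place).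

    The blocks before k have a fixed finite support, so B^n makes them small
    as soon as the weights lambda(par^n(u) -> u) are small on that support.
    The blocks after k are chosen so small that even the factor M^n, a bound
    for the norm of B^n, does not make them visible. Hence B^n P(g) is close
    to c y (shift_peval_close). Every triple (N, W, y), with y in a countable
    dense family, is used infinitely often, so all non-zero polynomials
    without constant term in the generators are hypercyclic (HC_peval_gen).

    The vector g_i is moreover a small perturbation of y_i, so the generators
    are themselves dense (gen_dense). They are algebraically independent since
    a hypercyclic vector is not 0 (hypercyclic_generated). *)

(** * The modulus of a complex number *)

Section Modulus.
Variable R : realType.
Implicit Types (z w : R[i]) (r : R).

Lemma normr_normc z : `|z| = (normc z)%:C.
Proof. by rewrite normc_def; case: z. Qed.

Lemma normc_ge0 z : 0 <= normc z.
Proof. by case: z => a b; exact: sqrtr_ge0. Qed.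

Lemma normc_eq0 z : (normc z == 0) = (z == 0).
Proof.
apply/eqP/eqP => [/ComplexField.Normc.eq0_normc //|->].
exact: ComplexField.Normc.normc0.
Qed.

Lemma normcX z n : normc (z ^+ n) = normc z ^+ n.
Proof. by apply: (@complexI R); rewrite rmorphXn /= -!normr_normc normrX. Qed.

Lemma normcD z w : normc (z + w) <= normc z + normc w.
Proof. by rewrite -lecR rmorphD /= -!normr_normc ler_normD. Qed.

Lemma normcN z : normc (- z) = normc z.
Proof. by apply: (@complexI R); rewrite -!normr_normc normrN. Qed.

Lemma normc_sum I (s : seq I) (P : pred I) (F : I -> R[i]) :
  normc (\sum_(i <- s | P i) F i) <= \sum_(i <- s | P i) normc (F i).
Proof.
rewrite -lecR -normr_normc rmorph_sum /=.
apply: le_trans (ler_norm_sum _ _ _) _.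
by apply: ler_sum => i _; rewrite normr_normc.
Qed.

Lemma normc_real r : normc r%:C = `|r|.
Proof. by rewrite /normc /= expr0n /= addr0 sqrtr_sqr. Qed.

Lemma normc_Re z : `|complex.Re z| <= normc z.
Proof. by rewrite -lecR -normr_normc normc_ge_Re. Qed.

Lemma normc_Im z : `|complex.Im z| <= normc z.
Proof.
case: z => a b; rewrite /normc /= -sqrtr_sqr ler_wsqrtr //.
by rewrite lerDr sqr_ge0.
Qed.

Lemma normc_ReIm z : normc z <= `|complex.Re z| + `|complex.Im z|.
Proof.
case: z => a b /=.
rewrite /normc -(ler_pXn2r (n := 2)) ?nnegrE ?sqrtr_ge0 ?addr_ge0 //.
rewrite sqr_sqrtr ?addr_ge0 ?sqr_ge0 // sqrrD !real_normK ?num_real //.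
by rewrite lerD2r lerDl mulrn_wge0 ?mulr_ge0.
Qed.

End Modulus.

(** * The spaces of p-summable families *)

Lemma esumZ_le (R : realType) (T : choiceType) (D : set T) (a : T -> \bar R)
    (r : R) : 0 <= r -> (forall t, (0 <= a t)%E) ->
  (\esum_(t in D) (r%:E * a t) <= r%:E * \esum_(t in D) a t)%E.
Proof.
move=> r0 a0; apply: ge_ereal_sup => _ [X [finX XD] <-].
rewrite -ge0_mule_fsumr // lee_wpmul2l ?lee_fin //.
by apply: ereal_sup_ubound; exists X.
Qed.

Lemma sum_delta (T : eqType) (R : pzRingType) (s : seq T) (F : T -> R) v :
  uniq s -> \sum_(u <- s) F u * (v == u)%:R = if v \in s then F v else 0.
Proof.
move=> s_uniq; case: ifPn => vs; last first.
  rewrite big_seq big1 // => u us.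
  case: eqVneq => [vu|_]; last by rewrite mulr0.
  by rewrite vu us in vs.
rewrite (bigD1_seq v) //= eqxx mulr1 big1 ?addr0 // => u.
by rewrite eq_sym => /negPf->; rewrite mulr0.
Qed.

Section LpSpace.
Variables (R : realType) (A : countType) (p : R).
Hypothesis p_ge1 : 1 <= p.
Implicit Types (f g : A -> R[i]) (c : R[i]) (e : R).

Let p_gt0 : 0 < p := lt_le_trans ltr01 p_ge1.

(** The p-th power of the norm, which avoids roots in estimates. *)
Definition energy f : \bar R :=
  \esum_(v in [set: A]) (normc (f v) `^ p)%:E.

Definition l1norm f : \bar R := \esum_(v in [set: A]) (normc (f v))%:E.

Lemma energy_ge0 f : (0 <= energy f)%E.
Proof. by apply: esum_ge0 => v _; rewrite lee_fin powR_ge0. Qed.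

Lemma l1norm_ge0 f : (0 <= l1norm f)%E.
Proof. by apply: esum_ge0 => v _; rewrite lee_fin normc_ge0. Qed.

Lemma lpnorm_ge0 f : (0 <= lpnorm p f)%E.
Proof. exact: poweR_ge0. Qed.

Lemma le_poweR (q : R) (x y : \bar R) : 0 <= q -> (0 <= x)%E -> (x <= y)%E ->
  (x `^ q <= y `^ q)%E.
Proof.
move=> q0 x0 xy; apply: gt0_ler_poweR => //; rewrite in_itv /= leey andbT //.
exact: le_trans xy.
Qed.

Lemma energyE f : energy f = (lpnorm p f `^ p)%E.
Proof.
by rewrite /lpnorm -poweRrM mulVf ?gt_eqF // poweRe1 // energy_ge0.
Qed.

Lemma le_lpnorm_energy f (x : \bar R) :
  (0 <= x)%E -> (energy f <= x `^ p)%E -> (lpnorm p f <= x)%E.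
Proof.
move=> x0 fx; rewrite -[leRHS]poweRe1 // -(mulfV (lt0r_neq0 p_gt0)) poweRrM.
by apply: le_poweR => //; [rewrite invr_ge0 ltW|exact: energy_ge0].
Qed.

Lemma lp_energy f : lp p f <-> (energy f < +oo)%E.
Proof.
split; first by move=> fp; rewrite energyE poweR_lty.
by move=> fp; rewrite /lp /= /lpnorm poweR_lty.
Qed.

Lemma le_energy f g : (forall v, normc (f v) <= normc (g v)) ->
  (energy f <= energy g)%E.
Proof.
move=> fg; apply: le_esum => v _; rewrite lee_fin.
by rewrite ge0_ler_powR ?(ltW p_gt0) ?nnegrE ?normc_ge0.
Qed.

Lemma le_lpnorm f g : (forall v, normc (f v) <= normc (g v)) ->
  (lpnorm p f <= lpnorm p g)%E.
Proof.
by move=> /le_energy fg; rewrite le_lpnorm_energy ?lpnorm_ge0 -?energyE.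
Qed.

Lemma lp_le f g : (forall v, normc (f v) <= normc (g v)) -> lp p g -> lp p f.
Proof. by move=> /le_lpnorm; exact: le_lt_trans. Qed.

(** This follows from (x + y)^p <= (2 x)^p + (2 y)^p, and the constant 4 is
    harmless in statements about density. *)
Lemma lpnormD f g : (lpnorm p (f + g)%R <= 4%:E * (lpnorm p f + lpnorm p g))%E.
Proof.
have [f0 g0] := (lpnorm_ge0 f, lpnorm_ge0 g).
have fg0 : (0 <= lpnorm p f + lpnorm p g)%E by rewrite adde_ge0.
apply: le_lpnorm_energy; first by rewrite mule_ge0.
apply: (@le_trans _ _ ((2 `^ p)%:E * (energy f + energy g))%E).
  rewrite -esumD; last 2 first.
  - by move=> v _; rewrite lee_fin powR_ge0.
  - by move=> v _; rewrite lee_fin powR_ge0.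
  apply: le_trans; last first.
    by apply: esumZ_le => [|v]; rewrite ?adde_ge0 ?lee_fin ?powR_ge0.
  apply: le_esum => v _; rewrite -EFinD -EFinM lee_fin.
  wlog fg : f g {f0 g0 fg0} / normc (f v) <= normc (g v).
    move=> h; have [|/ltW] := leP (normc (f v)) (normc (g v)); first exact: h.
    by move=> /h; rewrite (addrC g f) (addrC (_ `^ p)).
  apply: (@le_trans _ _ ((2 * normc (g v)) `^ p)).
    rewrite ge0_ler_powR ?(ltW p_gt0) ?nnegrE ?normc_ge0 //.
      by rewrite mulr_ge0 ?normc_ge0.
    apply: le_trans (normcD _ _) _.
    by rewrite mulr2n mulrDl mul1r lerD2r.
  rewrite powRM ?normc_ge0 // ler_wpM2l ?powR_ge0 // lerDr powR_ge0 //.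
have -> : (4%:E = 2%:E * 2%:E :> \bar R)%E by rewrite -EFinM; congr EFin; lra.
rewrite -muleA poweRM ?mule_ge0 // poweRM // -poweR_EFin.
apply: lee_wpmul2l; first exact: poweR_ge0.
apply: (@le_trans _ _ (2%:E * (lpnorm p f + lpnorm p g) `^ p)%E).
  rewrite !energyE mule_natl mule2n.
  apply: leeD; rewrite le_poweR ?(ltW p_gt0) //.
    by rewrite leeDl.
  by rewrite leeDr.
apply: lee_wpmul2r; first exact: poweR_ge0.
by rewrite poweR_EFin lee_fin le1r_powR // ler1n.
Qed.

Lemma lpnormB_sym f g : lpnorm p (f - g)%R = lpnorm p (g - f)%R.
Proof.
congr poweR; apply: eq_esum => v _.
by rewrite !fctE -opprB -[normc _]/(normc (- (g v - f v))) normcN.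
Qed.

Lemma lpD f g : lp p f -> lp p g -> lp p (f + g).
Proof.
move=> fp gp; apply: le_lt_trans (lpnormD f g) _.
rewrite lte_mul_pinfty // lte_add_pinfty //.
Qed.

Lemma lpnormZ c f :
  (lpnorm p (fun v => c * f v)%R <= (normc c)%:E * lpnorm p f)%E.
Proof.
apply: le_lpnorm_energy.
  by rewrite mule_ge0 ?lpnorm_ge0 ?lee_fin ?normc_ge0.
rewrite poweRM ?lpnorm_ge0 ?lee_fin ?normc_ge0 // -energyE poweR_EFin.
apply: le_trans; last first.
  by apply: esumZ_le => [|v]; rewrite ?lee_fin ?powR_ge0.
apply: le_esum => v _.
by rewrite ComplexField.Normc.normcM powRM ?normc_ge0.
Qed.

Lemma lpZ c f : lp p f -> lp p (fun v => c * f v).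
Proof.
move=> fp; apply: le_lt_trans (lpnormZ c f) _.
by rewrite lte_mul_pinfty ?lee_fin ?normc_ge0.
Qed.

Lemma lp_bounded f : lp p f -> exists2 H, 0 <= H & forall v, normc (f v) <= H.
Proof.
move=> /lp_energy fp; exists (fine (energy f) `^ p^-1); first exact: powR_ge0.
move=> v; rewrite -[leLHS]powRr1 ?normc_ge0 //.
rewrite -(mulfV (lt0r_neq0 p_gt0)) powRrM.
have e_fin : energy f \is a fin_num by rewrite ge0_fin_numE ?energy_ge0.
rewrite ge0_ler_powR ?invr_ge0 ?(ltW p_gt0) ?nnegrE ?powR_ge0 //.
  by rewrite fine_ge0 ?energy_ge0.
rewrite -lee_fin fineK //; apply: esum_ge; exists [set v].
  by split=> //; exact: finite_set1.
by rewrite fsbig_set1.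
Qed.

Lemma lpM f g : lp p f -> lp p g -> lp p (f * g).
Proof.
move=> fp gp; have [H H0 fH] := lp_bounded fp.
apply: (@lp_le _ (fun v => H%:C * g v)); last exact: lpZ.
move=> v; rewrite !ComplexField.Normc.normcM normc_real ger0_norm //.
by rewrite ler_wpM2r ?normc_ge0.
Qed.

(** Every coordinate is at most s, the sum of all of them, hence
    x^p <= s^(p - 1) x. *)
Lemma lpnorm_le_l1norm f : (lpnorm p f <= l1norm f)%E.
Proof.
have [f_oo|f_fin] := leP +oo%E (l1norm f); first by rewrite (le_trans (leey _)).
have s_fin : l1norm f \is a fin_num by rewrite ge0_fin_numE ?l1norm_ge0.
apply: le_lpnorm_energy; first exact: l1norm_ge0.
set s := fine (l1norm f); have sE : l1norm f = s%:E by rewrite fineK.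
have s0 : 0 <= s by rewrite fine_ge0 ?l1norm_ge0.
apply: (@le_trans _ _ ((s `^ (p - 1))%:E * l1norm f)%E); last first.
  by rewrite sE poweR_EFin -EFinM lee_fin mulrC mulr_powRB1.
apply: le_trans; last first.
  by apply: esumZ_le => [|v]; rewrite ?lee_fin ?powR_ge0 ?normc_ge0.
apply: le_esum => v _; rewrite -EFinM lee_fin.
rewrite -(mulr_powRB1 (normc_ge0 _) p_gt0) [leRHS]mulrC ler_wpM2l ?normc_ge0 //.
rewrite ge0_ler_powR ?subr_ge0 ?nnegrE ?normc_ge0 //.
rewrite -lee_fin -sE; apply: esum_ge; exists [set v].
  by split=> //; exact: finite_set1.
by rewrite fsbig_set1.
Qed.

Lemma lp_l1 f : (l1norm f < +oo)%E -> lp p f.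
Proof. exact/le_lt_trans/lpnorm_le_l1norm. Qed.

Lemma lpnorm_delta v : lpnorm p (fun u : A => (u == v)%:R : R[i]) = 1%E.
Proof.
rewrite /lpnorm (_ : esum _ _ = 1%E) ?poweR1r //.
rewrite (esumID [set v]); last by move=> u _; rewrite lee_fin powR_ge0.
rewrite setTI esum_set1 ?lee_fin ?powR_ge0 //.
rewrite eqxx ComplexField.Normc.normc1 powR1.
rewrite esum1 ?adde0 // => u [_ /eqP/negPf->].
by rewrite ComplexField.Normc.normc0 powR0 // gt_eqF.
Qed.

(** The points g u may coincide, which can only lower the norm. *)
Lemma l1norm_comb (s : seq A) (a : A -> R[i]) (g : A -> A) :
  (l1norm (fun v => \sum_(u <- s) a u * (v == g u)%:R)%R
     <= (\sum_(u <- s) normc (a u))%R%:E)%E.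
Proof.
apply: (@le_trans _ _ (\esum_(v in [set: A])
    \sum_(u <- s) (normc (a u) * (v == g u)%:R)%:E)%E).
  apply: le_esum => v _; rewrite sumEFin lee_fin.
  apply: le_trans (normc_sum _ _ _) _; apply: ler_sum => u _.
  rewrite ComplexField.Normc.normcM; case: (v == g u).
    by rewrite ComplexField.Normc.normc1.
  by rewrite ComplexField.Normc.normc0.
rewrite esum_sum; last by move=> v u _ _; rewrite lee_fin mulr_ge0 ?normc_ge0.
rewrite -sumEFin; apply: lee_sum => u _.
rewrite (esumID [set g u]); last first.
  by move=> v _; rewrite lee_fin mulr_ge0 ?normc_ge0.
rewrite setTI esum_set1 ?lee_fin ?mulr_ge0 ?normc_ge0 // eqxx mulr1.
by rewrite esum1 ?adde0 // => v [_ /eqP/negPf->]; rewrite mulr0.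
Qed.

End LpSpace.

(** * The backward shift and its powers *)

Section Shift.
Variables (R : realType) (A : countType).
Implicit Types (f g : A -> R[i]) (D : set A).

(** The common form of the real and the imaginary part of csum. *)
Definition rsum D (x : A -> R) : R :=
  fine (esum D (fun v => (x v)%:E)^\+ - esum D (fun v => (x v)%:E)^\-)%E.

Lemma csumE D f :
  csum D f = rsum D (@complex.Re R \o f) +i* rsum D (@complex.Im R \o f).
Proof. by []. Qed.

(** The positive part of x + y is not the sum of the positive parts; the two
    decompositions of x + y as a difference of non-negative families are
    compared by esumB. *)
Lemma rsumD D (x y : A -> R) :
  summable D (fun v => (x v)%:E) -> summable D (fun v => (y v)%:E) ->
  rsum D (fun v => x v + y v) = rsum D x + rsum D y.
Proof.
move=> sx sy; rewrite /rsum.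
set X : A -> \bar R := fun v => (x v)%:E.
set Y : A -> \bar R := fun v => (y v)%:E.
have [px py] := (summable_funepos sx, summable_funepos sy).
have [nx ny] := (summable_funeneg sx, summable_funeneg sy).
have esum_fin (z : A -> \bar R) : summable D z -> (forall v, 0 <= z v)%E ->
    esum D z \is a fin_num.
  move=> + z0; rewrite summableE; congr (_ \is a fin_num).
  by apply: eq_esum => v _; rewrite gee0_abs.
have p0 (z : A -> \bar R) v : (0 <= z^\+ v)%E by exact: funepos_ge0.
have n0 (z : A -> \bar R) v : (0 <= z^\- v)%E by exact: funeneg_ge0.
have -> : (fun v => (x v + y v)%:E) =
    ((X^\+ \+ Y^\+) \- (X^\- \+ Y^\-))%E.
  apply/funext => v; rewrite /= EFinD -/(X v) -/(Y v).
  rewrite [in LHS](funeposneg X) [in LHS](funeposneg Y) /=.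
  rewrite oppeD; first by rewrite addeACA.
  by rewrite fin_num_adde_defr // funenegE -EFinN -EFin_max.
rewrite esumB; last 4 first.
- exact: summableD.
- exact: summableD.
- by move=> v _; rewrite adde_ge0.
- by move=> v _; rewrite adde_ge0.
rewrite (esumD (a := X^\+%E)) // (esumD (a := X^\-%E)) //.
rewrite oppeD ?fin_num_adde_defr ?esum_fin // addeACA fineD //.
  by rewrite fin_numB !esum_fin.
by rewrite fin_numB !esum_fin.
Qed.

Lemma rsum_single D (x : A -> R) u : (forall v, v != u -> x v = 0) ->
  rsum D x = if u \in D then x u else 0.
Proof.
move=> x0; rewrite /rsum.
have one (z : A -> \bar R) : (forall v, 0 <= z v)%E ->
    (forall v, v != u -> z v = 0%E) ->
    esum D z = (if u \in D then z u else 0)%E.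
  move=> z0 zu; rewrite esum_mkcond (esumID [set u]); last first.
    by move=> v _; case: ifP.
  rewrite setTI esum_set1; last by case: ifP.
  by rewrite esum1 ?adde0 // => v [_ /eqP/zu ->]; rewrite if_same.
rewrite !one; last 4 first.
- by move=> v; exact: funeneg_ge0.
- by move=> v /x0 xv; rewrite funenegE xv oppe0 maxxx.
- by move=> v; exact: funepos_ge0.
- by move=> v /x0 xv; rewrite funeposE xv maxxx.
case: ifP => _; last by rewrite sube0.
by rewrite -[LHS]/(fine ((fun v => _ - _)%E u)) -funeposneg.
Qed.

Lemma csummable_ReIm D f : csummable D f ->
  summable D (fun v => (complex.Re (f v))%:E) /\
  summable D (fun v => (complex.Im (f v))%:E).
Proof.
move=> sf; split; apply: le_lt_trans sf; apply: le_esum => v _;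
  rewrite /= lee_fin (ger0_norm (normc_ge0 _)).
  exact: normc_Re.
exact: normc_Im.
Qed.

Lemma csumD D f g : csummable D f -> csummable D g ->
  csum D (fun v => f v + g v) = csum D f + csum D g.
Proof.
move=> /csummable_ReIm[fr fi] /csummable_ReIm[gr gi]; rewrite !csumE.
have -> (x y z t : R) : (x +i* y) + (z +i* t) = (x + z) +i* (y + t) by [].
rewrite -!rsumD //; congr (rsum D _ +i* rsum D _); apply/funext => v /=;
  by case: (f v) (g v) => [? ?] [].
Qed.

Lemma csum_single D f u : (forall v, v != u -> f v = 0) ->
  csum D f = if u \in D then f u else 0.
Proof.
move=> f0; rewrite csumE !(@rsum_single _ _ u) => [|v /f0|v /f0]; last 2 first.
- by rewrite /= => ->.
- by rewrite /= => ->.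
by case: ifP => // _ /=; case: (f u).
Qed.

End Shift.

Section ShiftPowers.
Variables (R : realType) (A : countType) (E : rel A) (lam : A -> R[i]) (p : R).
Hypothesis p_ge1 : 1 <= p.
Hypothesis parent_uniq : forall a a' b : A, E a b -> E a' b -> a = a'.
Hypothesis unrooted_E : unrooted E.
Implicit Types (f g a : A -> R[i]) (s : seq A).

Let B := Bshift E lam.
Let anc n : A -> A := iter n (par E).
Let wt := path_weight E lam.

Lemma par_edge u : E (par E u) u.
Proof.
rewrite /par; case: xgetP => [a _ //|no_parent].
by have [a /no_parent] := unrooted_E u.
Qed.

Lemma Chi_par v u : Chi E v u <-> v = par E u.
Proof.
split; first by move=> vu; exact: parent_uniq vu (par_edge u).
by move=> ->; exact: par_edge.
Qed.

Lemma Chin_anc n v u : Chin E n v u -> anc n u = v.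
Proof.
elim: n u => [u -> //|n IH u [w /IH <- /Chi_par ->]].
by rewrite /anc iterSr.
Qed.

Lemma path_weightS n u : wt n.+1 u = lam u * wt n (par E u).
Proof.
rewrite /wt /path_weight big_ord_recl /=; congr (_ * _).
by apply: eq_bigr => k _; rewrite -iterSr.
Qed.

Lemma Bshift_single (c : R[i]) u :
  B (fun v => c * (v == u)%:R) = fun v => c * lam u * (v == par E u)%:R.
Proof.
apply/funext => v; rewrite /B /Bshift (@csum_single _ _ _ _ u); last first.
  by move=> w /negPf->; rewrite !mulr0.
rewrite eqxx mulr1; case: (eqVneq v (par E u)) => [->|v_ne].
  by rewrite mem_set ?mulr1 1?mulrC //; exact/Chi_par.
rewrite memNset ?mulr0 // => /Chi_par uv.
by rewrite uv eqxx in v_ne.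
Qed.

Lemma iter_shift_single n (c : R[i]) u :
  iter n B (fun v => c * (v == u)%:R) =
  fun v => c * wt n u * (v == anc n u)%:R.
Proof.
elim: n c u => [|n IH] c u.
  by rewrite /= /wt /path_weight big_ord0 mulr1.
rewrite iterSr Bshift_single IH path_weightS /anc iterSr.
by apply/funext => v; rewrite !mulrA.
Qed.

Hypothesis csummable_B :
  forall f, lp p f -> forall v, csummable (Chi E v) (fun u => lam u * f u).
Variable M : R.
Hypothesis M_ge1 : 1 <= M.
Hypothesis B_le : forall f, lp p f -> (lpnorm p (B f) <= M%:E * lpnorm p f)%E.

Lemma iter_shift_le n f : lp p f ->
  lp p (iter n B f) /\ (lpnorm p (iter n B f) <= (M ^+ n)%:E * lpnorm p f)%E.
Proof.
move=> fp; elim: n => [|n [IHp IHle]]; first by rewrite expr0 mul1e.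
have le_n : (lpnorm p (iter n.+1 B f) <= (M ^+ n.+1)%:E * lpnorm p f)%E.
  apply: le_trans (B_le IHp) _; rewrite exprS EFinM -muleA.
  by rewrite lee_wpmul2l ?lee_fin // (le_trans ler01).
split=> //; apply: le_lt_trans le_n _.
by rewrite lte_mul_pinfty // lee_fin exprn_ge0 // (le_trans ler01).
Qed.

Lemma iter_shiftD n f g : lp p f -> lp p g ->
  iter n B (f + g) = iter n B f + iter n B g.
Proof.
move=> fp gp; elim: n => //= n ->; apply/funext => v.
have [[fn _] [gn _]] := (iter_shift_le n fp, iter_shift_le n gp).
rewrite /B /Bshift -[RHS]csumD; [|exact: csummable_B..].
by congr csum; apply/funext => u; rewrite mulrDr.
Qed.

Lemma iter_shift0 n : iter n B 0 = 0.
Proof.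
elim: n => //= n ->; apply/funext => v.
rewrite /B /Bshift (@csum_single _ _ _ _ v) => [|u _].
  by rewrite mulr0 if_same.
by rewrite mulr0.
Qed.

Lemma lp_comb s a : lp p (fun v => \sum_(u <- s) a u * (v == u)%:R).
Proof.
by apply: lp_l1 => //; exact: le_lt_trans (l1norm_comb s a id) (ltry _).
Qed.

Lemma HC_neq0 : [set: A] !=set0 -> ~ HC p B 0.
Proof.
move=> [v _] [_ dense].
have delta_lp : lp p (fun u : A => (u == v)%:R : R[i]).
  by rewrite /lp /= lpnorm_delta // ltry.
have [_ [n _ <-]] := dense _ delta_lp _ ltr01.
by rewrite iter_shift0 subr0 lpnorm_delta // ltxx.
Qed.

(** On finite combinations the powers of the shift are explicit: each vertex
    moves to its n-th ancestor. *)
Lemma iter_shift_comb n s a :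
  iter n B (fun v => \sum_(u <- s) a u * (v == u)%:R) =
  fun v => \sum_(u <- s) a u * wt n u * (v == anc n u)%:R.
Proof.
elim: s => [|u s IH].
  under eq_fun do rewrite big_nil.
  by rewrite iter_shift0; apply/funext => v; rewrite big_nil.
have -> : (fun v => \sum_(w <- u :: s) a w * (v == w)%:R) =
    (fun v => a u * (v == u)%:R) + (fun v => \sum_(w <- s) a w * (v == w)%:R).
  by apply/funext => v; rewrite big_cons.
rewrite iter_shiftD ?IH ?iter_shift_single.
- by apply/funext => v; rewrite big_cons.
- have := lp_comb [:: u] a; congr (lp p _).
  by apply/funext => v; rewrite big_seq1.
- exact: lp_comb.
Qed.

End ShiftPowers.

(** * A countable family of targets *)

Section Targets.
Variables (R : realType) (A : countType) (p : R).
Hypothesis p_ge1 : 1 <= p.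
Implicit Types (f : A -> R[i]) (c : seq (rat * rat)).

Definition verts k : seq A := pmap (@pickle_inv A) (iota 0 k).

Lemma mem_verts k v : (v \in verts k) = (pickle v < k)%N.
Proof.
rewrite /verts; apply/idP/idP; last first.
  move=> vk; rewrite mem_pmap -(pickleK_inv v); apply: map_f.
  by rewrite mem_iota.
rewrite mem_pmap => vk; have [i ik iv] := mapP vk; move: ik.
by rewrite mem_iota; have := @pickle_invK A i; rewrite -iv /= => ->.
Qed.

Lemma size_verts k : (size (verts k) <= k)%N.
Proof. by rewrite size_pmap -[leqRHS](size_iota 0) count_size. Qed.

Lemma verts_uniq k : uniq (verts k).
Proof. by apply: pmap_uniq (iota_uniq _ _) => //; exact: pickle_invK. Qed.

(** Entry i of the list is the value at the vertex of number i; the default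
    value makes the family vanish beyond the end of the list. *)
Definition ratfun c : A -> R[i] := fun v =>
  let q := nth (0, 0) c (pickle v) in ratr q.1 +i* ratr q.2.

Lemma ratfun_out c v : (size c <= pickle v)%N -> ratfun c v = 0.
Proof. by move=> cv; rewrite /ratfun nth_default //= !rmorph0. Qed.

Lemma complex_rat_approx (z : R[i]) (e : R) : 0 < e ->
  exists q : rat * rat, normc (z - (ratr q.1 +i* ratr q.2)) <= e.
Proof.
move=> e0; case: z => a b.
have approx (x : R) : exists q : rat, `|x - ratr q| <= e / 2.
  have [|q] := @rat_in_itvoo R (x - e / 2) (x + e / 2).
    by rewrite ltrD2l -subr_gt0 opprK addr_gt0 ?divr_gt0.
  by rewrite in_itv /= => /andP[xq qx]; exists q; rewrite ler_norml; lra.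
have [[q qa] [r rb]] := (approx a, approx b); exists (q, r).
apply: le_trans (normc_ReIm _) _.
by rewrite (splitr e) lerD.
Qed.

Lemma lp_tail f (e : R) : lp p f -> 0 < e ->
  exists n, (lpnorm p (fun v => if v \in verts n then 0 else f v)%R <= e%:E)%E.
Proof.
move=> /(lp_energy p_ge1) f_lty e0.
have f_fin : energy p f \is a fin_num by rewrite ge0_fin_numE ?energy_ge0.
have ep0 : 0 < e `^ p by rewrite powR_gt0.
have [_ [X [finX _] <-] fX] := ub_ereal_sup_adherent ep0 f_fin.
have /finite_seqP[s Xs] := finX.
exists (\max_(v <- s) pickle v).+1; set V := verts _.
have a0 v : (0 <= (normc (f v) `^ p)%:E)%E by rewrite lee_fin powR_ge0.
apply: le_lpnorm_energy => //; first by rewrite lee_fin ltW.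
have -> : energy p (fun v => if v \in V then 0 else f v) =
    \esum_(v in setT `&` ~` [set` V]) (normc (f v) `^ p)%:E.
  rewrite esum_mkcondr; apply: eq_esum => v _; case: ifPn => vV.
    rewrite memNset; last by move/(_ vV).
    by rewrite ComplexField.Normc.normc0 powR0 // gt_eqF // (lt_le_trans ltr01).
  by rewrite mem_set //=; exact/negP.
set x := esum _ _; move: fX; rewrite -[ereal_sup _]/(energy p f) poweR_EFin.
have : energy p f = (\esum_(v in [set` V]) (normc (f v) `^ p)%:E + x)%E.
  by rewrite /energy (esumID [set` V]) // setTI.
set y := esum _ _; move: (energy p f) f_fin => [r| |] // _ fxy.
have Xy : (\sum_(v \in X) (normc (f v) `^ p)%:E <= y)%E.
  apply: esum_ge; exists X => //; split=> // v; rewrite Xs /= => vs.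
  by rewrite mem_verts ltnS (leq_bigmax_seq (F := pickle)).
move=> /lt_le_trans/(_ Xy); have x0 : (0 <= x)%E by exact: esum_ge0.
have y0 : (0 <= y)%E by exact: esum_ge0.
move: x y x0 y0 fxy {Xy} => [x| |] [y| |] //= _ _ [->].
by rewrite -EFinB lte_fin lee_fin; lra.
Qed.

(** Truncate to finitely many vertices, then approximate by rationals at
    each of them; 12 leaves room for the constant 4 of lpnormD. *)
Lemma ratfun_dense f (e : R) : lp p f -> 0 < e ->
  exists c, (lpnorm p (f - ratfun c)%R < e%:E)%E.
Proof.
move=> fp e0; have e12 : 0 < e / 12 by rewrite divr_gt0.
have [n fn] := lp_tail fp e12.
have d0 : 0 < e / 12 / (n.+1)%:R by rewrite divr_gt0.
have /choice[q qP] := fun v => complex_rat_approx (f v) d0.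
pose c := mkseq (fun i => if pickle_inv i is Some v then q v else (0, 0)) n.
have cP v : v \in verts n -> normc (f v - ratfun c v) <= e / 12 / (n.+1)%:R.
  by rewrite mem_verts => vn; rewrite /ratfun nth_mkseq // pickleK_inv.
pose g v := \sum_(u <- verts n) (f u - ratfun c u) * (v == u)%:R.
exists c; rewrite [X in lpnorm p X](_ : _ =
    (fun v => if v \in verts n then 0 else f v) + g); last first.
  apply/funext => v; rewrite !fctE /g sum_delta ?verts_uniq //.
  case: ifPn => vn; rewrite ?add0r // ratfun_out ?subr0 ?addr0 //.
  by rewrite size_mkseq leqNgt -mem_verts.
apply: le_lt_trans (lpnormD p_ge1 _ _) _.
apply: (@le_lt_trans _ _ (4%:E * ((e / 12)%:E + (e / 12)%:E))%E); last first.
  by rewrite -EFinD -EFinM lte_fin; lra.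
rewrite lee_wpmul2l ?lee_fin // leeD //.
apply: le_trans (lpnorm_le_l1norm p_ge1 _) _.
apply: le_trans (l1norm_comb _ _ id) _; rewrite lee_fin.
apply: (@le_trans _ _ (\sum_(u <- verts n) e / 12 / (n.+1)%:R)).
  by rewrite big_seq [leRHS]big_seq; apply: ler_sum.
rewrite big_const_seq count_predT iter_addr_0 -[leLHS]mulr_natr.
move: (e / 12) e12 => d d_gt0 {d0 cP fn q qP c g}.
rewrite mulrAC ler_pdivrMr // ler_wpM2l ?(ltW d_gt0) // ler_nat.
by rewrite (leq_trans (size_verts _)).
Qed.

End Targets.

Lemma inj_unbounded (phi : nat -> nat) K : injective phi ->
  exists j, (K <= phi j)%N.
Proof.
move=> phi_inj; have [//|/forallNP small] := pselect (exists j, (K <= phi j)%N).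
have : uniq (map phi (iota 0 K.+1)) by rewrite map_inj_uniq ?iota_uniq.
move=> /uniq_leq_size le_size.
have sub : {subset map phi (iota 0 K.+1) <= iota 0 K}.
  move=> i /seq.mapP[j _ ->]; rewrite mem_iota ltnNge; exact/negP/small.
by have := le_size _ sub; rewrite size_map !size_iota ltnn.
Qed.

(** A sequence that takes every value of T infinitely often: the second
    component of the decoded pair is a dummy. *)
Definition datum (T : countType) (x0 : T) (k : nat) : T :=
  if @unpickle (T * nat)%type k is Some (x, _) then x else x0.

Lemma datum_recurrent (T : countType) (x0 x : T) K :
  exists2 k, (K <= k)%N & datum x0 k = x.
Proof.
have [|j Kj] := @inj_unbounded (fun j => pickle (x, j)) K.
  by move=> i j /(pcan_inj pickleK)[].
by exists (pickle (x, j)) => //; rewrite /datum pickleK.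
Qed.

(** * Choosing the blocks *)

Lemma near_all_seq (T : eqType) (s : seq T) (Q : T -> nat -> Prop) :
  (forall x, x \in s -> \forall k \near \oo, Q x k) ->
  \forall k \near \oo, forall x, x \in s -> Q x k.
Proof.
elim: s => [|x s IH] sQ; first by apply: nearW.
have Qx := sQ x (mem_head x s).
have Qs : \forall k \near \oo, forall x, x \in s -> Q x k.
  by apply: IH => y ys; apply: sQ; rewrite inE ys orbT.
near=> k => y; rewrite inE => /predU1P[->|]; first by near: k.
by move: y; near: k.
Unshelve. all: by end_near. Qed.

Section Selection.
Variables (R : realType) (A : countType) (E : rel A) (lam : A -> R[i]).
Variable n_ : nat -> nat.
Hypothesis parent_uniq : forall a a' b : A, E a b -> E a' b -> a = a'.
Hypothesis unrooted_E : unrooted E.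
Hypothesis sup_children : forall v : A,
  ereal_sup [set (normc (path_weight E lam (n_ k) u))%:E
            | u in Chin E (n_ k) v] @[k --> \oo] --> +oo%E.
Hypothesis weight_parents : forall v : A,
  (path_weight E lam (n_ k) v : R[i]^o) @[k --> \oo] --> (0 : R[i]^o).

Let anc n : A -> A := iter n (par E).
Let wt := path_weight E lam.

Lemma near_small_weight u (e : R) : 0 < e ->
  \forall k \near \oo, normc (wt (n_ k) u) <= e.
Proof.
move=> e0; have /cvgrPdist_le /(_ e%:C) := weight_parents u.
rewrite ltcR => /(_ e0); apply: filterS => k /=.
by rewrite sub0r normrN normr_normc lecR.
Qed.

Lemma near_big_weight v (H : R) :
  \forall k \near \oo, exists u, anc (n_ k) u = v /\ H < normc (wt (n_ k) u).
Proof.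
have /cvgeyPgt /(_ H) := sup_children v.
apply: filterS => k /ereal_sup_gt[_ [u uv <-]]; rewrite lte_fin => Hu.
by exists u; split=> //; exact: Chin_anc uv.
Qed.

(** The new vertices phi v avoid S for free: the weights on S are at most 1
    and those of the new vertices are larger than 1. *)
Lemma block_choice (S V : seq A) (y : A -> R[i]) (e d : R) : 0 < e -> 0 < d ->
  exists n (phi : A -> A),
    [/\ forall u, u \in S -> normc (wt n u) <= e,
        forall v, v \in V -> anc n (phi v) = v,
        forall v, v \in V -> phi v \notin S,
        forall v, v \in V -> wt n (phi v) != 0
      & forall v, v \in V -> normc (y v) <= d * normc (wt n (phi v))].
Proof.
move=> e0 d0; have e10 : 0 < Num.min e 1 by rewrite lt_min e0 ltr01.
have small := @near_all_seq _ S _ (fun u _ => near_small_weight u e10).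
have big := @near_all_seq _ V _
  (fun v _ => near_big_weight v (Num.max 1 (normc (y v) / d))).
have [k [Sk Vk]] := filter_ex (filterI small big).
have /choice[phi phiP] : forall v, exists u, v \in V ->
    anc (n_ k) u = v /\ Num.max 1 (normc (y v) / d) < normc (wt (n_ k) u).
  move=> v; have [/Vk[u uv]|vV] := boolP (v \in V); first by exists u.
  by exists v.
have large v : v \in V -> 1 < normc (wt (n_ k) (phi v)).
  by move=> /phiP[_]; rewrite gt_max => /andP[].
exists (n_ k), phi; split.
- by move=> u /Sk; rewrite le_min => /andP[].
- by move=> v /phiP[].
- move=> v /large big_v; apply/negP => /Sk; rewrite le_min => /andP[_].
  by rewrite leNgt big_v.
- move=> v /large; rewrite -normc_eq0.
  by apply: contraTneq => ->; rewrite ltr10.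
- move=> v /phiP[_]; rewrite gt_max => /andP[_ /ltW].
  by rewrite ler_pdivrMr // mulrC.
Qed.

End Selection.

(** * Exponents in base N *)

Section Exponents.

Lemma digits_uniq N D (a b : nat -> nat) :
  (forall i, (a i < N)%N) -> (forall i, (b i < N)%N) ->
  (\sum_(i < D) a i * N ^ i = \sum_(i < D) b i * N ^ i)%N ->
  forall i, (i < D)%N -> a i = b i.
Proof.
elim: D a b => // D IH a b aN bN; rewrite !big_ord_recl !expn0 !muln1.
have shift (c : nat -> nat) : (\sum_(i < D) c (lift ord0 i) * N ^ lift ord0 i =
    N * \sum_(i < D) c i.+1 * N ^ i)%N.
  rewrite big_distrr /=; apply: eq_bigr => i _.
  by rewrite /bump add1n expnS mulnCA.
rewrite !shift => ab.
have N0 : (0 < N)%N by exact: leq_ltn_trans (aN 0%N).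
have ab0 : a 0%N = b 0%N.
  have := congr1 (modn^~ N) ab.
  by rewrite /= ![(_ + N * _)%N]addnC ![(N * _)%N]mulnC !modnMDl !modn_small.
move: ab; rewrite ab0 => /addnI/eqP; rewrite eqn_pmul2l // => /eqP ab.
by case=> [//|i] iD; 
exact: (IH (fun j => a j.+1) (fun j => b j.+1) (fun j => aN j.+1)
  (fun j => bN j.+1) ab).
Qed.

(** The exponent of t in the monomial m when t^(N^(s j)) is substituted for
    the j-th variable. *)
Definition expo d (s : 'I_d -> nat) N (m : multinom d) : nat :=
  (\sum_(j < d) m j * N ^ s j)%N.

(** Since s is injective, expo s N m is the number whose base-N digit of
    index s j is m j. *)
Lemma expo_inj d (s : 'I_d -> nat) N (m m' : multinom d) : injective s ->
  (forall j, (m j < N)%N) -> (forall j, (m' j < N)%N) ->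
  expo s N m = expo s N m' -> m = m'.
Proof.
move=> s_inj mN m'N.
pose D := (\max_(j < d) s j).+1.
have sD j : (s j < D)%N by rewrite ltnS leq_bigmax.
pose digit (q : multinom d) i := (\sum_(j < d | s j == i) q j)%N.
have digitE q j : digit q (s j) = q j.
  by rewrite /digit (big_pred1 j) // => j' /=; rewrite (inj_eq s_inj).
have expoE q : expo s N q = (\sum_(i < D) digit q i * N ^ i)%N.
  rewrite /expo (partition_big (fun j => Ordinal (sD j)) xpredT) //=.
  apply: eq_bigr => i _; rewrite big_distrl /=.
  by apply: eq_big => [j|j /eqP <-//]; rewrite -val_eqE.
have [N0|N0] := posnP N.
  by move=> _; apply/mnmP => j; have := mN j; rewrite N0.
have dN (q : multinom d) : (forall j, (q j < N)%N) ->
    forall i, (digit q i < N)%N.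
  move=> qN i; case: (pickP (fun j => s j == i)) => [j /eqP<-|no_j].
    by rewrite digitE.
  by rewrite /digit big_pred0.
rewrite !expoE => /(digits_uniq (dN _ mN) (dN _ m'N)) eq_digits.
by apply/mnmP => j; rewrite -[m j]digitE -[m' j]digitE eq_digits.
Qed.

Lemma expo_gt0 d (s : 'I_d -> nat) N (m : multinom d) : (0 < N)%N ->
  m != mnm0 -> (0 < expo s N m)%N.
Proof.
move=> N0; apply: contra_neqT; rewrite -eqn0Ngt /expo sum_nat_eq0.
move=> /forallP m0; apply/mnmP => j; have := m0 j.
by rewrite mnm0E muln_eq0 expn_eq0 [N == _]eqn0Ngt N0 orbF => /eqP.
Qed.

Lemma msupp_neq0 (R : nzRingType) d (P : mpoly d R) m :
  mcoeff mnm0 P = 0 -> m \in msupp P -> m != mnm0.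
Proof. by move=> Pc; apply: contraTneq => ->; rewrite mcoeff_msupp Pc eqxx. Qed.

Lemma seq_min (T : eqType) (s : seq T) (F : T -> nat) : s != [::] ->
  exists2 x, x \in s & forall y, y \in s -> (F x <= F y)%N.
Proof.
elim: s => // x [|x' s] IH _.
  by exists x; rewrite ?mem_head // => y; rewrite inE => /eqP->.
have [//|z zs zmin] := IH.
have [xz|zx] := leqP (F x) (F z).
  exists x; rewrite ?mem_head // => y; rewrite inE => /predU1P[->//|/zmin].
  exact: leq_trans.
exists z; first by rewrite inE zs orbT.
by move=> y; rewrite inE => /predU1P[->|/zmin//]; exact: ltnW.
Qed.

(** As soon as N exceeds all exponents in P, distinct monomials of P have
    distinct values of expo, so the minimum is attained once. *)
Lemma least_monomial (R : nzRingType) d (s : 'I_d -> nat) (P : mpoly d R) :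
  injective s -> P != 0 -> mcoeff mnm0 P = 0 ->
  exists N m0, [/\ (0 < N)%N, m0 \in msupp P, (0 < expo s N m0)%N
    & forall m, m \in msupp P -> m != m0 -> (expo s N m0 < expo s N m)%N].
Proof.
Proof.
move=> s_inj P0 Pc; have P_supp : msupp P != [::] by rewrite msupp_eq0.
have digit_lt m j : m \in msupp P -> (m j < msize P)%N.
  move=> /msize_mdeg_lt; apply: leq_ltn_trans.
  by rewrite mdegE (bigD1 j) //= leq_addr.
have N0 : (0 < msize P)%N by rewrite lt0n msize_poly_eq0.
have [m0 m0P m0_min] := seq_min (expo s (msize P)) P_supp.
(* The size of P exceeds its degree, hence all its exponents. *)
exists (msize P), m0; split=> //.
  by rewrite expo_gt0 // (msupp_neq0 Pc).
move=> m mP; apply: contraR; rewrite -leqNgt => le_m.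
apply/eqP/(expo_inj s_inj (N := msize P)) => [j|j|]; [exact: digit_lt..|].
by apply/eqP; rewrite eqn_leq le_m m0_min.
Qed.

End Exponents.

(** * The generators *)

Section Generators.
Variables (R : realType) (A : countType) (E : rel A) (lam : A -> R[i]) (p : R).
Hypothesis p_ge1 : 1 <= p.
Hypothesis parent_uniq : forall a a' b : A, E a b -> E a' b -> a = a'.
Hypothesis unrooted_E : unrooted E.
Hypothesis csummable_B :
  forall f, lp p f -> forall v, csummable (Chi E v) (fun u => lam u * f u).
Variable M : R.
Hypothesis M_ge1 : 1 <= M.

Let B := Bshift E lam.
Let anc n : A -> A := iter n (par E).
Let wt := path_weight E lam.

Hypothesis B_le : forall f, lp p f -> (lpnorm p (B f) <= M%:E * lpnorm p f)%E.

(** Stage k aims at the family y_ k, by means of polynomials whose least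
    exponent in the auxiliary variable t is W_ k when the i-th generator is
    t^(N_ k ^ i). *)
Variables (N_ W_ : nat -> nat) (y_ : nat -> A -> R[i]).
Hypothesis N_gt0 : forall k, (0 < N_ k)%N.
Hypothesis W_gt0 : forall k, (0 < W_ k)%N.
Hypothesis y_out : forall k v, v \notin verts A k -> y_ k v = 0.

(** With auxiliary values at most radius k d, their sum over the at most k
    vertices of stage k stays below d, even after weighting by the target. *)
Definition radius k (d : R) : R :=
  d / (k.+1%:R * (1 + \sum_(v <- verts A k) normc (y_ k v))).

(** S is the set of vertices already decided, n the power of the shift and
    phi v the descendant of v that will carry the value y_ k v. *)
Record block_spec k (S : seq A) (d : R) (n : nat) (phi : A -> A) : Prop := {
  block_old : forall u, u \in S -> normc (wt n u) <= d / (size S).+1%:R;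
  block_anc : forall v, v \in verts A k -> anc n (phi v) = v;
  block_new : forall v, v \in verts A k -> phi v \notin S;
  block_neq0 : forall v, v \in verts A k -> wt n (phi v) != 0;
  block_le : forall v, v \in verts A k ->
    normc (y_ k v) <= radius k d ^+ W_ k * normc (wt n (phi v)) }.

Variable sel : nat -> seq A -> R -> nat * (A -> A).
Hypothesis selP : forall k S d, 0 < d ->
  block_spec k S d (sel k S d).1 (sel k S d).2.

(** The vertices decided before stage k and the budget of stage k. The factor
    2 makes the budgets of all later stages add up to at most twice the next
    one, and M ^+ b.1 cancels the expansion by the shift applied at stage k. *)
Fixpoint stage k : seq A * R :=
  if k is j.+1 then
    let S := (stage j).1 ++ verts A j in
    let b := sel j S (stage j).2 in
    (S ++ map b.2 (verts A j), (stage j).2 / 2 / M ^+ b.1)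
  else ([::], 1).

Definition used k := (stage k).1.
Definition budget k := (stage k).2.
Definition old k := used k ++ verts A k.
Definition shifts k := (sel k (old k) (budget k)).1.
Definition place k := (sel k (old k) (budget k)).2.
Definition small k := radius k (budget k).

Lemma usedS k : used k.+1 = old k ++ map (place k) (verts A k).
Proof. by []. Qed.

Lemma budgetS k : budget k.+1 = budget k / 2 / M ^+ shifts k.
Proof. by []. Qed.

Lemma budget_gt0 k : 0 < budget k.
Proof.
elim: k => [|k IH]; first exact: ltr01.
by rewrite budgetS !divr_gt0 // exprn_gt0 // (lt_le_trans ltr01).
Qed.

Lemma stageP k : block_spec k (old k) (budget k) (shifts k) (place k).
Proof. exact/selP/budget_gt0. Qed.

Lemma budgetS_half k : 2 * budget k.+1 <= budget k.
Proof.
rewrite budgetS; set m := (_ ^+ _)^-1.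
have -> : 2 * (budget k / 2 * m) = budget k * m by field.
rewrite ler_piMr ?(ltW (budget_gt0 _)) //.
by rewrite invf_le1 ?exprn_ege1 // exprn_gt0 // (lt_le_trans ltr01).
Qed.

Lemma budget_le k : budget k <= (k.+1%:R)^-1.
Proof.
have [b0 bS] := (budget_gt0, budgetS_half).
apply: (@le_trans _ _ ((2 ^+ k)^-1)); last first.
  by rewrite lef_pV2 ?posrE ?exprn_gt0 // -natrX ler_nat ltn_expl.
elim: k => [|k IH]; first by rewrite expr0 invr1.
rewrite exprS invfM ler_pdivlMl //; exact: le_trans (bS k) IH.
Qed.

Lemma budget_le1 k : budget k <= 1.
Proof. by apply: le_trans (budget_le k) _; rewrite invf_le1 // ler1n. Qed.

Let ysum k : R := \sum_(v <- verts A k) normc (y_ k v).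

Lemma ysum_ge0 k : 0 <= ysum k.
Proof. by apply: sumr_ge0 => v _; exact: normc_ge0. Qed.

Lemma small_gt0 k : 0 < small k.
Proof.
by rewrite divr_gt0 ?budget_gt0 // mulr_gt0 // ltr_pwDl // ysum_ge0.
Qed.

Lemma small_sums k :
  k.+1%:R * small k <= budget k /\ ysum k * small k <= budget k.
Proof.
have k1 : 1 <= k.+1%:R :> R by rewrite ler1n.
have y0 := ysum_ge0 k; have b0 := ltW (budget_gt0 k).
have q0 : 0 < k.+1%:R * (1 + ysum k) :> R.
  by rewrite mulr_gt0 ?ltr_pwDl // (lt_le_trans ltr01).
rewrite /small /radius -/(ysum k) !mulrA ![_ * budget k]mulrC.
rewrite !ler_pdivrMr //; split; rewrite ler_wpM2l //; nra.
Qed.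

Lemma small_le k : small k <= budget k.
Proof.
have [h _] := small_sums k; apply: le_trans h.
by rewrite ler_peMl ?(ltW (small_gt0 k)) // ler1n.
Qed.

Lemma small_le1 k : small k <= 1.
Proof. exact: le_trans (small_le k) (budget_le1 k). Qed.

Lemma used_subset j k : (j <= k)%N -> {subset used j <= used k}.
Proof.
move=> /subnK <-; elim: (k - j)%N => // m IH u /IH; rewrite addSn usedS.
by rewrite /old !mem_cat => ->.
Qed.

Lemma verts_used k : {subset verts A k <= used k.+1}.
Proof. by move=> u uk; rewrite usedS /old !mem_cat uk orbT. Qed.

Lemma birth_ex u : exists k, u \in used k.+1.
Proof. by exists (pickle u).+1; apply: verts_used; rewrite mem_verts. Qed.

(** The stage at which the value of the generators at u is decided. *)
Definition birth u := ex_minn (birth_ex u).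

Lemma birth_le k u : (u \in used k.+1) = (birth u <= k)%N.
Proof.
rewrite /birth; case: ex_minnP => m um m_min; apply/idP/idP; first exact: m_min.
by move=> mk; apply: used_subset um.
Qed.

Lemma birth_lt k u : (u \in used k) = (birth u < k)%N.
Proof. by case: k => [|k]; rewrite ?birth_le. Qed.

Lemma verts_birth k u : u \in verts A k -> (birth u <= k)%N.
Proof. by rewrite -birth_le => /verts_used. Qed.

Lemma birth_place k v : v \in verts A k -> birth (place k v) = k.
Proof.
move=> vk; apply/eqP; rewrite eqn_leq -birth_le usedS mem_cat map_f // orbT /=.
rewrite leqNgt -birth_lt; apply: contra (block_new (stageP k) vk).
by rewrite mem_cat => ->.
Qed.

Lemma place_inj k : {in verts A k &, injective (place k)}.
Proof.
move=> v w vk wk /(congr1 (anc (shifts k))).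
by rewrite !(block_anc (stageP k)).
Qed.

(** The auxiliary number t at u: a W-th root of the target divided by the
    weight, if u carries a value at the stage of its birth. *)
Definition zeta u : R[i] :=
  let k := birth u in
  if u \in map (place k) (verts A k) then
    (W_ k).-root (y_ k (anc (shifts k) u) / wt (shifts k) u)
  else 0.

Lemma zeta_place k v : v \in verts A k ->
  zeta (place k v) ^+ W_ k * wt (shifts k) (place k v) = y_ k v.
Proof.
move=> vk; rewrite /zeta birth_place // map_f // rootCK //.
by rewrite (block_anc (stageP k)) // divfK // (block_neq0 (stageP k)).
Qed.

Lemma zeta_le u : normc (zeta u) <= small (birth u).
Proof.
have [|u_place] := boolP (u \in map (place (birth u)) (verts A (birth u)));
    last first.
  by rewrite /zeta ifN // ComplexField.Normc.normc0 ltW // small_gt0.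
move: (birth u) => k /mapP[v vk ->]; rewrite -(ler_pXn2r (W_gt0 k)) ?nnegrE.
- have w0 : 0 < normc (wt (shifts k) (place k v)).
    by rewrite lt0r normc_ge0 normc_eq0 (block_neq0 (stageP k)).
  rewrite -(ler_pM2r w0) -normcX -ComplexField.Normc.normcM zeta_place //.
  exact: (block_le (stageP k)).
- exact: normc_ge0.
- exact/ltW/small_gt0.
Qed.

Lemma zeta_le1 u : normc (zeta u) <= 1.
Proof. exact: le_trans (zeta_le u) (small_le1 _). Qed.

(** Sums of this family control everything that stages from k on add to the
    generators. *)
Definition zeta_from k u : R[i] := if (k <= birth u)%N then zeta u else 0.

(** Stage k contributes at most k nonzero values, each at most small k. *)
Lemma zeta_stage_sum (s : seq A) k : uniq s ->
  \sum_(u <- s | birth u == k) normc (zeta u) <= budget k.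
Proof.
move=> s_uniq; pose L := map (place k) (verts A k).
rewrite (bigID (mem L)) /= [X in _ + X]big1 ?addr0; last first.
  move=> u /andP[/eqP uk uL]; rewrite /zeta uk ifN //.
  exact: ComplexField.Normc.normc0.
apply: (@le_trans _ _ (\sum_(u <- s | (birth u == k) && (u \in L)) small k)).
  by apply: ler_sum => u /andP[/eqP <- _]; exact: zeta_le.
rewrite big_const_seq iter_addr_0; have [h _] := small_sums k.
apply: le_trans h; rewrite -[leLHS]mulr_natl ler_wpM2r ?(ltW (small_gt0 k)) //.
rewrite ler_nat -size_filter; apply: (@leq_trans (size L)).
  apply: uniq_leq_size; first exact: filter_uniq.
  by move=> u; rewrite mem_filter => /andP[/andP[]].
by rewrite size_map (leq_trans (size_verts _ _)).
Qed.

(** The budgets from k on add up to at most 2 budget k, by telescoping of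
    budget j <= 2 budget j - 2 budget (j + 1). *)
Lemma zeta_sum (s : seq A) k : uniq s ->
  \sum_(u <- s) normc (zeta_from k u) <= 2 * budget k.
Proof.
move=> s_uniq.
pose term J := \sum_(u <- s | (birth u < J)%N) normc (zeta_from k u).
have termS J : term J.+1 =
    term J + \sum_(u <- s | birth u == J) normc (zeta_from k u).
  rewrite /term (bigID (fun u => birth u == J)) /= addrC; congr (_ + _).
    by apply: eq_bigl => u; rewrite ltnS [RHS]ltn_neqAle andbC.
  apply: eq_bigl => u; rewrite andbC; case: eqP => // ->; exact: ltnSn.
have bound J : term (k + J)%N <= 2 * budget k - 2 * budget (k + J).
  elim: J => [|J IH].
    rewrite addn0 subrr /term big1 // => u uk.
    by rewrite /zeta_from leqNgt uk ComplexField.Normc.normc0.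
  rewrite addnS termS; have h := budgetS_half (k + J).
  have h' : \sum_(u <- s | birth u == (k + J)%N) normc (zeta_from k u) <=
      budget (k + J).
    apply: le_trans (zeta_stage_sum _ s_uniq); apply: ler_sum => u /eqP uk.
    by rewrite /zeta_from uk leq_addr.
  move: h h' IH; lra.
pose J := (\max_(u <- s) birth u).+1.
have -> : \sum_(u <- s) normc (zeta_from k u) = term (k + J)%N.
  rewrite /term big_seq_cond [RHS]big_seq_cond; apply: eq_bigl => u.
  case: (boolP (u \in s)) => //= us; symmetry.
  by rewrite ltn_addl // ltnS (leq_bigmax_seq (F := birth)).
apply: le_trans (bound J) _.
by rewrite lerBlDr lerDl mulr_ge0 // ltW // budget_gt0.
Qed.

Lemma l1norm_zeta k : (l1norm (zeta_from k) <= (2 * budget k)%:E)%E.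
Proof.
apply: ge_ereal_sup => _ [X [/finite_seqP[s ->] _] <-].
have -> : [set` s] = [set` undup s].
  by apply/seteqP; split=> u /=; rewrite mem_undup.
rewrite -fsbig_seq ?undup_uniq // sumEFin lee_fin.
exact/zeta_sum/undup_uniq.
Qed.

(** The generator of index i starts as y_ i and takes part in the stages after
    i only, so that it remains close to y_ i. *)
Definition gen i u : R[i] :=
  if (i < birth u)%N then zeta u ^+ (N_ (birth u) ^ i) else y_ i u.

Lemma expr_normc_le (z : R[i]) n : normc z <= 1 -> (0 < n)%N ->
  normc (z ^+ n) <= normc z.
Proof.
by move=> z1 n0; rewrite normcX -[leRHS]expr1 ler_wiXn2l ?normc_ge0.
Qed.

Lemma gen_close i : (lpnorm p (gen i - y_ i)%R <= (2 * budget i.+1)%:E)%E.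
Proof.
apply: le_trans (l1norm_zeta _); apply: le_trans (lpnorm_le_l1norm p_ge1 _).
apply: le_lpnorm => // u; rewrite !fctE /gen /zeta_from.
case: ifPn => iu; last by rewrite subrr.
rewrite y_out ?subr0; last first.
  by apply: contraL iu => /verts_birth; rewrite -leqNgt.
by apply: expr_normc_le; rewrite ?zeta_le1 ?expn_gt0 ?N_gt0.
Qed.

Lemma y_comb k : y_ k = fun v => \sum_(u <- verts A k) y_ k u * (v == u)%:R.
Proof.
apply/funext => v; rewrite sum_delta ?verts_uniq //.
by case: ifPn => // /y_out.
Qed.

Hypothesis recurrent : forall N W c K, (0 < N)%N -> (0 < W)%N ->
  exists k, [/\ (K <= k)%N, N_ k = N, W_ k = W & y_ k = ratfun R c].

Lemma gen_dense : lp_dense p (range gen).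
Proof.
move=> f fp e e0; have e16 : 0 < e / 16 by rewrite divr_gt0.
have [c fc] := ratfun_dense p_ge1 fp e16.
have [k [Kk _ _ yk]] :=
  recurrent c (Num.bound (2 / (e / 16))) (ltn0Sn 0) (ltn0Sn 0).
exists (gen k); first by exists k.
rewrite (_ : f - gen k = (f - ratfun R c) + (y_ k - gen k)); last first.
  by rewrite yk addrA subrK.
apply: le_lt_trans (lpnormD p_ge1 _ _) _.
apply: (@le_lt_trans _ _ (4%:E * ((e / 16)%:E + (e / 16)%:E))%E); last first.
  by rewrite -EFinD -EFinM lte_fin; lra.
rewrite lee_wpmul2l ?lee_fin // leeD ?(ltW fc) //.
rewrite lpnormB_sym //; apply: le_trans (gen_close k) _; rewrite lee_fin.
apply: (@le_trans _ _ (2 * k.+2%:R^-1)).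
  by rewrite ler_wpM2l // budget_le.
rewrite ler_pdivrMr // mulrC -ler_pdivrMr //.
apply: le_trans (ltW (archi_boundP _)) _; first by rewrite divr_ge0 // ltW.
by rewrite ler_nat (leq_trans Kk) // -addn2 leq_addr.
Qed.

(** * Polynomials in the generators *)

Section Polynomial.
Variables (d : nat) (s : 'I_d -> nat) (P : mpoly d R[i]).
Hypothesis s_inj : injective s.
Hypothesis P_const : mcoeff mnm0 P = 0.

Let h : A -> R[i] := peval P (fun j => gen (s j)).
Let C : R := \sum_(m <- msupp P) normc (mcoeff m P).

Lemma coef_sum_ge0 : 0 <= C.
Proof. by apply: sumr_ge0 => m _; exact: normc_ge0. Qed.

(** Away from the finitely many vertices of the first stages, the value of
    the polynomial depends on the auxiliary variable only. *)
Lemma peval_genE u : (forall j, (s j < birth u)%N) ->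
  h u = \sum_(m <- msupp P) mcoeff m P * zeta u ^+ expo s (N_ (birth u)) m.
Proof.
move=> su; rewrite /h /peval mevalE; apply: eq_bigr => m _; congr (_ * _).
rewrite /expo expr_sum; apply: eq_bigr => j _.
by rewrite /gen su -exprM mulnC.
Qed.

Lemma peval_gen_le u : (forall j, (s j < birth u)%N) ->
  normc (h u) <= C * normc (zeta u).
Proof.
move=> su; rewrite peval_genE //; apply: le_trans (normc_sum _ _ _) _.
rewrite /C big_distrl /= big_seq [leRHS]big_seq; apply: ler_sum => m mP.
rewrite ComplexField.Normc.normcM ler_wpM2l ?normc_ge0 //.
apply: expr_normc_le; first exact: zeta_le1.
by rewrite expo_gt0 // (msupp_neq0 P_const).
Qed.

(** At a vertex chosen for v, the monomial of least degree hits its target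
    exactly and every other one is smaller by a factor zeta. *)
Lemma peval_gen_place k v m0 : (forall j, (s j < k)%N) -> v \in verts A k ->
  m0 \in msupp P -> expo s (N_ k) m0 = W_ k ->
  (forall m, m \in msupp P -> m != m0 ->
     (expo s (N_ k) m0 < expo s (N_ k) m)%N) ->
  normc (h (place k v) * wt (shifts k) (place k v) - mcoeff m0 P * y_ k v)
    <= C * (normc (y_ k v) * small k).
Proof.
move=> sk vk m0P m0W m0_min; have lk := birth_place vk.
rewrite peval_genE ?lk //; set z := zeta _; set w := wt _ _.
have zw : z ^+ W_ k * w = y_ k v := zeta_place vk.
have z_le : normc z <= small k by rewrite -lk; exact: zeta_le.
rewrite (bigD1_seq m0) ?msupp_uniq //= mulrDl m0W -mulrA zw addrAC subrr add0r.
rewrite big_distrl /=; apply: le_trans (normc_sum _ _ _) _.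
rewrite /C big_distrl /= [leRHS](bigD1_seq m0) ?msupp_uniq //=.
apply: (@le_trans _ _ (\sum_(m <- msupp P | m != m0)
    normc (mcoeff m P) * (normc (y_ k v) * small k))); last first.
  have k0 := ltW (small_gt0 k); rewrite lerDr mulr_ge0 ?normc_ge0 //.
  exact: mulr_ge0 (normc_ge0 _) k0.
rewrite big_seq_cond [leRHS]big_seq_cond; apply: ler_sum => m /andP[mP mm0].
rewrite -mulrA ComplexField.Normc.normcM ler_wpM2l ?normc_ge0 //.
have := m0_min m mP mm0; rewrite m0W => Wm.
rewrite -(subnK (ltnW Wm)) exprD -mulrA zw ComplexField.Normc.normcM mulrC.
rewrite ler_wpM2l ?normc_ge0 //; apply: le_trans z_le.
by apply: expr_normc_le; rewrite ?zeta_le1 // subn_gt0.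
Qed.

Lemma l1norm_peval_tail k : (forall j, (s j < k)%N) ->
  (l1norm (fun u => if (k < birth u)%N then h u else 0)%R
    <= (C * (2 * budget k.+1))%:E)%E.
Proof.
move=> sk.
apply: (@le_trans _ _ (C%:E * l1norm (zeta_from k.+1))%E); last first.
  by rewrite EFinM lee_wpmul2l ?lee_fin ?coef_sum_ge0 // l1norm_zeta.
apply: le_trans; last first.
  apply: esumZ_le; first exact: coef_sum_ge0.
  by move=> u; rewrite lee_fin normc_ge0.
apply: le_esum => u _; rewrite -EFinM lee_fin /zeta_from.
case: ifPn => ku; last by rewrite ComplexField.Normc.normc0 mulr0.
by apply: peval_gen_le => j; exact: ltn_trans (sk j) ku.
Qed.

(** The vector h is cut into the vertices of the earlier stages (g1), those of
    stage k, where the target appears (g2), and those of the later stages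
    (g3); each error is at most a multiple of budget k. *)
Lemma shift_peval_close k m0 H : (forall j, (s j < k)%N) ->
  lp p h -> 0 <= H -> (forall u, normc (h u) <= H) ->
  m0 \in msupp P -> expo s (N_ k) m0 = W_ k ->
  (forall m, m \in msupp P -> m != m0 ->
     (expo s (N_ k) m0 < expo s (N_ k) m)%N) ->
  (lpnorm p (iter (shifts k) B h - (fun v => mcoeff m0 P * y_ k v))%R
    <= ((4 * H + 32 * C) * budget k)%:E)%E.
Proof.
move=> sk hp H0 hH m0P m0W m0_min.
have b0 := ltW (budget_gt0 k); have C0 := coef_sum_ge0.
pose s1 := undup (old k); pose s2 := map (place k) (verts A k).
pose g3 u := if (k < birth u)%N then h u else 0.
have s12_uniq : uniq (s1 ++ s2).
  rewrite cat_uniq undup_uniq map_inj_in_uniq ?verts_uniq ?andbT /=; last first.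
    by move=> v w vk wk; exact: place_inj.
  apply/hasPn => u /mapP[v vk ->]; rewrite /= mem_undup.
  exact: (block_new (stageP k) vk).
have mem_s12 u : (u \in s1 ++ s2) = (birth u <= k)%N.
  by rewrite -birth_le usedS [LHS]mem_cat [RHS]mem_cat mem_undup.
have hE : h = (fun v => \sum_(u <- s1 ++ s2) h u * (v == u)%:R) + g3.
  apply/funext => v; rewrite fctE sum_delta // mem_s12 /g3 ltnNge.
  by case: ifP; rewrite ?addr0 ?add0r.
have g3_l1 := l1norm_peval_tail sk; rewrite -/g3 in g3_l1.
have g3p : lp p g3 by apply: lp_l1 => //; exact: le_lt_trans g3_l1 (ltry _).
pose g1 v :=
  \sum_(u <- s1) (h u * wt (shifts k) u) * (v == anc (shifts k) u)%:R.
pose g2 v := \sum_(w <- verts A k)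
  (h (place k w) * wt (shifts k) (place k w) - mcoeff m0 P * y_ k w)
    * (v == w)%:R.
rewrite [X in lpnorm p X](_ : _ = g1 + (g2 + iter (shifts k) B g3)); last first.
  rewrite {1}hE (iter_shiftD csummable_B M_ge1 B_le) //; last exact: lp_comb.
  rewrite (iter_shift_comb p_ge1 parent_uniq unrooted_E csummable_B M_ge1 B_le).
  apply/funext => v; rewrite !fctE big_cat big_map /= -/(g1 v).
  rewrite -!addrA; congr (_ + _); rewrite addrC -addrA addrC; congr (_ + _).
  rewrite [X in _ * X](_ : _ =
      \sum_(w <- verts A k) y_ k w * (v == w)%:R); last first.
    by rewrite {1}y_comb.
  rewrite big_distrr /= -sumrN -big_split /= /g2.
  rewrite big_seq [RHS]big_seq; apply: eq_bigr => w wk.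
  have := block_anc (stageP k) wk; rewrite /anc => ->.
  by rewrite mulrBl mulrA addrC.
have g1_le : (lpnorm p g1 <= (H * budget k)%:E)%E.
  apply: le_trans (lpnorm_le_l1norm p_ge1 _) _.
  apply: le_trans (l1norm_comb _ _ _) _; rewrite lee_fin.
  apply: (@le_trans _ _ (\sum_(u <- s1) H * (budget k / (size (old k)).+1%:R))).
    rewrite big_seq [leRHS]big_seq; apply: ler_sum => u.
    rewrite mem_undup => uk.
    rewrite ComplexField.Normc.normcM ler_pM ?normc_ge0 //.
    exact: (block_old (stageP k)).
  rewrite big_const_seq count_predT iter_addr_0 -mulrnAr ler_wpM2l //.
  rewrite -[leLHS]mulr_natr mulrAC ler_pdivrMr // ler_wpM2l // ler_nat.
  by rewrite (leq_trans (size_undup _)).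
have g2_le : (lpnorm p g2 <= (C * budget k)%:E)%E.
  apply: le_trans (lpnorm_le_l1norm p_ge1 _) _.
  apply: le_trans (l1norm_comb _ _ id) _; rewrite lee_fin.
  apply: (@le_trans _ _ (\sum_(w <- verts A k) C * (normc (y_ k w) * small k))).
    rewrite big_seq [leRHS]big_seq; apply: ler_sum => w wk.
    exact: peval_gen_place.
  rewrite -big_distrr -big_distrl /= ler_wpM2l //.
  by have [_] := small_sums k.
have g3_le : (lpnorm p (iter (shifts k) B g3) <= (C * budget k)%:E)%E.
  have [_ le_n] := iter_shift_le M_ge1 B_le (shifts k) g3p.
  apply: le_trans le_n _.
  apply: (@le_trans _ _ ((M ^+ shifts k)%:E * (C * (2 * budget k.+1))%:E)%E).
    rewrite lee_wpmul2l ?lee_fin ?exprn_ge0 ?(le_trans ler01) //.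
    exact: le_trans (lpnorm_le_l1norm p_ge1 _) g3_l1.
  rewrite -EFinM lee_fin budgetS.
  have Mn : M ^+ shifts k != 0.
    by rewrite expf_neq0 // gt_eqF // (lt_le_trans ltr01).
  rewrite [leLHS](_ : _ = C * budget k) //.
  by field.
apply: le_trans (lpnormD p_ge1 _ _) _.
apply: (@le_trans _ _ (4%:E * ((H * budget k)%:E +
    4%:E * ((C * budget k)%:E + (C * budget k)%:E)))%E).
  rewrite lee_wpmul2l ?lee_fin // leeD //.
  apply: le_trans (lpnormD p_ge1 _ _) _.
  by rewrite lee_wpmul2l ?lee_fin // leeD.
by rewrite -!(EFinD, EFinM) lee_fin; lra.
Qed.

Lemma lp_peval_gen : lp p h.
Proof.
pose k := (\max_(j < d) s j).+1.
have sk j : (s j < k)%N by rewrite ltnS leq_bigmax.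
rewrite (_ : h = (fun v => \sum_(u <- undup (used k.+1)) h u * (v == u)%:R) +
    (fun u => if (k < birth u)%N then h u else 0)); last first.
  apply/funext => v; rewrite fctE sum_delta ?undup_uniq // mem_undup birth_le.
  by rewrite ltnNge; case: ifP; rewrite ?addr0 ?add0r.
apply: lpD => //; first exact: lp_comb.
by apply: lp_l1 => //; exact: le_lt_trans (l1norm_peval_tail sk) (ltry _).
Qed.

(** With y as its target, a stage approximates a y, where a is the
    coefficient of the least monomial; to approximate f, aim at f / a. *)
Lemma HC_peval_gen : P != 0 -> HC p B h.
Proof.
move=> P0; have hp := lp_peval_gen; split=> // f fp e e0.
have [N [m0 [N0 m0P W0 m0_min]]] := least_monomial s_inj P0 P_const.
have [H H0 hH] := lp_bounded p_ge1 hp.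
set a := mcoeff m0 P; have a0 : a != 0 by rewrite -mcoeff_msupp.
pose X := 4 * H + 32 * C.
have X0 : 0 <= X by rewrite addr_ge0 // mulr_ge0 // coef_sum_ge0.
have e16 : 0 < e / 16 by rewrite divr_gt0.
have a1 : 0 < 1 + normc a by rewrite ltr_pwDl // normc_ge0.
(* 1 + normc a absorbs the multiplication by a. *)
have [c fc] := ratfun_dense p_ge1 (lpZ p_ge1 a^-1 fp) (divr_gt0 e16 a1).
have [k [Kk Nk Wk yk]] := recurrent c
  (maxn (\max_(j < d) s j).+1 (Num.bound (X / (e / 16)))) N0 W0.
move: Kk; rewrite geq_max => /andP[sk Xk].
have {}sk j : (s j < k)%N by apply: leq_trans sk; rewrite ltnS leq_bigmax.
rewrite -Nk in m0_min; rewrite -Nk in Wk.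
have := shift_peval_close sk hp H0 hH m0P (esym Wk) m0_min.
rewrite -/a -/X yk => close.
exists (iter (shifts k) B h); first by exists (shifts k).
set g := iter _ _ _ in close *.
rewrite [X in lpnorm p X](_ : _ =
    (fun v => a * ((fun v => a^-1 * f v) - ratfun R c) v) +
    ((fun v => a * ratfun R c v) - g)); last first.
  apply/funext => v; rewrite !fctE mulrBr mulVKf //.
  by rewrite addrA subrK.
apply: le_lt_trans (lpnormD p_ge1 _ _) _.
apply: (@le_lt_trans _ _ (4%:E * ((e / 16)%:E + (e / 16)%:E))%E); last first.
  by rewrite -EFinD -EFinM lte_fin; lra.
rewrite lee_wpmul2l ?lee_fin // leeD //.
  apply: le_trans (lpnormZ p_ge1 _ _) _.
  apply: (@le_trans _ _ ((normc a)%:E * (e / 16 / (1 + normc a))%:E)%E).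
    by rewrite lee_wpmul2l ?lee_fin ?normc_ge0 // ltW.
  rewrite -EFinM lee_fin mulrA ler_pdivrMr // mulrC ler_wpM2l ?(ltW e16) //.
  by rewrite lerDr.
rewrite lpnormB_sym //; apply: le_trans close _; rewrite lee_fin.
apply: (@le_trans _ _ (X * k.+1%:R^-1)).
  by rewrite ler_wpM2l // budget_le.
rewrite ler_pdivrMr // mulrC -ler_pdivrMr //.
apply: le_trans (ltW (archi_boundP _)) _; first by rewrite divr_ge0 // ltW.
by rewrite ler_nat ltnW // ltnS.
Qed.

End Polynomial.

End Generators.

(** * The algebra generated by a sequence *)

Section GeneratedAlgebra.
Variables (R : realType) (A : countType) (p : R).
Hypothesis p_ge1 : 1 <= p.
Implicit Types (f g : A -> R[i]) (S G : set (A -> R[i])).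

Lemma subalgebra_lp_full : subalgebra p (lp p : set (A -> R[i])).
Proof.
split=> //.
- rewrite /lp /=; apply: lp_l1 => //; rewrite /l1norm esum1 ?ltry // => v _.
  by rewrite ComplexField.Normc.normc0.
- by move=> f g; exact: lpD.
- by move=> c f; exact: lpZ.
- by move=> f g; exact: lpM.
Qed.

Lemma smallest_subalgebra G : G `<=` lp p ->
  subalgebra p (smallest (subalgebra p) G).
Proof.
move=> Gp; split.
- by move=> f; apply; split=> //; exact: subalgebra_lp_full.
- by move=> S [[]].
- move=> f g Sf Sg S GS; case: (GS) => -[_ _ + _ _] _.
  by apply; [exact: Sf|exact: Sg].
- by move=> c f Sf S GS; case: (GS) => -[_ _ _ + _] _; apply; exact: Sf.
- move=> f g Sf Sg S GS; case: (GS) => -[_ _ _ _ +] _.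
  by apply; [exact: Sf|exact: Sg].
Qed.

(** In this form the vanishing of the constant term is stable under products
    and changes of variables. *)
Lemma mcoeff0_meval (K : comNzRingType) d (P : mpoly d K) :
  mcoeff mnm0 P = meval (fun=> 0) P.
Proof.
have mon (m : multinom d) : \prod_(j < d) (0 : K) ^+ m j = (m == mnm0)%:R.
  have [->|m0] := eqVneq m mnm0.
    by rewrite big1 // => j _; rewrite mnm0E.
  have /existsP[j mj] : [exists j, m j != 0%N].
    apply: contra_neqT m0 => /existsPn no_j; apply/mnmP => j.
    by rewrite mnm0E; apply/eqP; have := no_j j; rewrite negbK.
  by rewrite (bigD1 j) //= expr0n (negPf mj) mul0r.
rewrite mevalE; under eq_bigr do rewrite mon eq_sym.
rewrite sum_delta ?msupp_uniq //.
by rewrite mcoeff_msupp; case: eqP => // ->.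
Qed.

Definition widen_mpoly (K : comNzRingType) d n (dn : (d <= n)%N)
    (P : mpoly d K) : mpoly n K :=
  comp_mpoly [tuple mpolyX K (mnm1 (widen_ord dn j)) | j < d] P.

Lemma meval_widen (K : comNzRingType) d n (dn : (d <= n)%N) (P : mpoly d K) x :
  meval x (widen_mpoly dn P) = meval (fun j => x (widen_ord dn j)) P.
Proof.
rewrite /widen_mpoly comp_mpoly_meval; apply: meval_eq => j.
by rewrite tnth_mktuple mevalXU.
Qed.

Variable g_ : nat -> A -> R[i].

(** Polynomials in initial segments of the sequence suffice: any finite set of
    terms lies in one of them. *)
Definition poly_image : set (A -> R[i]) := [set f | exists n (P : mpoly n R[i]),
  mcoeff mnm0 P = 0 /\ f = peval P (fun j : 'I_n => g_ j)].

Lemma poly_image_common f g : poly_image f -> poly_image g ->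
  exists n (P Q : mpoly n R[i]), [/\ mcoeff mnm0 P = 0, mcoeff mnm0 Q = 0,
    f = peval P (fun j : 'I_n => g_ j) & g = peval Q (fun j : 'I_n => g_ j)].
Proof.
move=> [m [P [P0 ->]]] [n [Q [Q0 ->]]].
exists (maxn m n), (widen_mpoly (leq_maxl m n) P),
  (widen_mpoly (leq_maxr m n) Q).
move: P0 Q0; rewrite !mcoeff0_meval => P0 Q0; split.
- by rewrite meval_widen.
- by rewrite meval_widen.
- by apply/funext => v; rewrite /peval meval_widen.
- by apply/funext => v; rewrite /peval meval_widen.
Qed.

Hypothesis lp_poly : poly_image `<=` lp p.

Lemma subalgebra_poly_image : subalgebra p poly_image.
Proof.
split=> //.
- exists 0%N, 0; split; first by rewrite mcoeff0.
  by apply/funext => v; rewrite /peval meval0.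
- move=> f g /poly_image_common h /h [n [P [Q [P0 Q0 -> ->]]]].
  exists n, (P + Q); split; first by rewrite mcoeffD P0 Q0 addr0.
  by apply/funext => v; rewrite fctE /peval mevalD.
- move=> c f [n [P [P0 ->]]]; exists n, (c *: P).
  split; first by rewrite mcoeffZ P0 mulr0.
  by apply/funext => v; rewrite /peval mevalZ.
- move=> f g /poly_image_common h /h [n [P [Q [P0 Q0 -> ->]]]].
  exists n, (P * Q); split.
    by move: P0 Q0; rewrite !mcoeff0_meval mevalM => ->; rewrite mul0r.
  by apply/funext => v; rewrite fctE /peval mevalM.
Qed.

Lemma poly_image_gen i : poly_image (g_ i).
Proof.
exists i.+1, (mpolyX R[i] (mnm1 ord_max)); split.
  by rewrite mcoeff0_meval mevalXU.
by apply/funext => v; rewrite /peval mevalXU.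
Qed.

Lemma smallest_poly_image : smallest (subalgebra p) (range g_) `<=` poly_image.
Proof.
move=> f; apply; split; first exact: subalgebra_poly_image.
by move=> _ [i _ <-]; exact: poly_image_gen.
Qed.

Lemma lp_gens : range g_ `<=` lp p.
Proof. by move=> _ [i _ <-]; exact/lp_poly/poly_image_gen. Qed.

Variable T : (A -> R[i]) -> A -> R[i].
Hypothesis HC_neq0 : ~ HC p T 0.
Hypothesis HC_poly : forall d (s : 'I_d -> nat) (P : mpoly d R[i]),
  injective s -> P != 0 -> mcoeff mnm0 P = 0 ->
  HC p T (peval P (fun j => g_ (s j))).

(** Otherwise the polynomial X_0 - X_1, evaluated at two equal terms, would
    make 0 hypercyclic. *)
Lemma gens_inj : injective g_.
Proof.
move=> i j gij; apply/eqP; apply: contra_notT HC_neq0 => ij.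
pose s (a : 'I_2) := if a == ord0 then i else j.
pose P : mpoly 2 R[i] := mpolyX _ (mnm1 ord0) - mpolyX _ (mnm1 ord_max).
have s_inj : injective s.
  move=> a b; rewrite /s.
  case: (eqVneq a ord0) (eqVneq b ord0) => [->|a0] [->|b0] //.
  - by move=> h; rewrite h eqxx in ij.
  - by move=> h; rewrite h eqxx in ij.
  by move=> _; apply/val_inj; case: a b a0 b0 => [[|[|a]] ?] [[|[|b]] ?].
have P0 : P != 0.
  apply/negP => /eqP/(congr1 (meval (fun a => (a == ord0)%:R))).
  rewrite meval0 mevalB !mevalXU eqxx subr0 => /eqP.
  by rewrite oner_eq0.
have Pc : mcoeff mnm0 P = 0 by rewrite mcoeff0_meval mevalB !mevalXU subrr.
have := HC_poly s_inj P0 Pc; congr (HC p T _).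
by apply/funext => v; rewrite /peval mevalB !mevalXU /s /= gij subrr.
Qed.

Lemma hypercyclic_generated :
  hypercyclic_algebra p T (smallest (subalgebra p) (range g_)) /\
  countably_generated_free p (smallest (subalgebra p) (range g_)).
Proof.
split; last first.
  exists (range g_); split=> //.
  - exact: lp_gens.
  - exact: card_image_le.
  - rewrite (eq_finite_set (inj_card_eq _)) => [|i j _ _]; last exact: gens_inj.
    exact: infinite_nat.
  - move=> d g P _ g_inj gG P0 Pc.
    have /choice[s sg] : forall j, exists i, g_ i = g j.
      by move=> j; have [i _ <-] := gG j; exists i.
    have s_inj : injective s.
      by move=> i j ij; apply: g_inj; rewrite -!sg ij.
    move=> P_eq0; apply: HC_neq0; rewrite -P_eq0.
    have := HC_poly s_inj P0 Pc; congr (HC p T (peval P _)).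
    by apply/funext => j; rewrite sg.
split.
- exact/smallest_subalgebra/lp_gens.
- move=> S0; have g0 i : g_ i = 0.
    have : smallest (subalgebra p) (range g_) (g_ i).
      by apply: sub_gen_smallest; exists i.
    by rewrite S0.
  by have := gens_inj (etrans (g0 0%N) (esym (g0 1%N))).
- move=> f /smallest_poly_image[n [P [Pc ->]]].
  have [->|P0] := eqVneq P 0.
    by right; apply/funext => v; rewrite /peval meval0.
  by left; apply: HC_poly => //; exact: val_inj.
Qed.

End GeneratedAlgebra.

(** * The hypercyclic algebra *)

Theorem theorem4p4 (R : realType) (A : countType) (E : rel A)
    (lam : A -> R[i]) (p : R) (n_ : nat -> nat)
    (tree_E : directed_tree E) (unrooted_E : unrooted E)
    (leafless_E : leafless E) (p_ge1 : 1 <= p)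
    (lam_neq0 : forall v, lam v != 0)
    (bounded_B : Bshift_bounded E lam p)
    (sup_children : forall v : A,
      ereal_sup [set (normc (path_weight E lam (n_ k) u))%:E
                | u in Chin E (n_ k) v] @[k --> \oo] --> +oo%E)
    (weight_parents : forall v : A,
      (path_weight E lam (n_ k) v : R[i]^o) @[k --> \oo] --> (0 : R[i]^o)) :
  exists S : set (A -> R[i]),
    [/\ hypercyclic_algebra p (Bshift E lam) S, lp_dense p S
      & countably_generated_free p S].
Proof.
have parent_uniq := tree_parent tree_E.
have [csummable_B [M0 B_le0]] := bounded_B.
(* A bound at least 1, so that dividing by its powers lowers the budgets. *)
pose M := Num.max 1 M0; have M_ge1 : 1 <= M by rewrite le_max lexx.
have B_le f : lp p f -> (lpnorm p (Bshift E lam f) <= M%:E * lpnorm p f)%E.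
  move=> fp; apply: le_trans (B_le0 f fp) _.
  by rewrite lee_wpmul2r ?lpnorm_ge0 // lee_fin le_max lexx orbT.
(* Cutting the list at k puts the support of y_ k among the first k vertices. *)
pose dat k := @datum (nat * nat * seq (rat * rat))%type (0%N, 0%N, [::]) k.
pose N_ k := (dat k).1.1.+1; pose W_ k := (dat k).1.2.+1.
pose y_ k : A -> R[i] := ratfun R (take k (dat k).2).
have N_gt0 k : (0 < N_ k)%N by [].
have W_gt0 k : (0 < W_ k)%N by [].
have y_out k v : v \notin verts A k -> y_ k v = 0.
  rewrite mem_verts -leqNgt => kv; apply: ratfun_out.
  by rewrite size_take_min (leq_trans (geq_minl _ _)).
have recurrent N W c K : (0 < N)%N -> (0 < W)%N ->
    exists k, [/\ (K <= k)%N, N_ k = N, W_ k = W & y_ k = ratfun R c].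
  case: N W => // N [//|W] _ _.
  have [k] := datum_recurrent (0%N, 0%N, [::]) (N, W, c) (maxn K (size c)).
  rewrite geq_max => /andP[Kk ck] datk; exists k.
  by rewrite /N_ /W_ /y_ /dat datk take_oversize.
have /choice[sel selP] : forall x : nat * seq A * R, exists b : nat * (A -> A),
    0 < x.2 -> block_spec E lam W_ y_ x.1.1 x.1.2 x.2 b.1 b.2.
  move=> [[k S] d] /=; have [d0|] := boolP (0 < d); last first.
    by move=> _; exists (0%N, id).
  have r0 : 0 < radius y_ k d.
    rewrite divr_gt0 // mulr_gt0 // ltr_pwDl //.
    by apply: sumr_ge0 => v _; exact: normc_ge0.
  have [n [phi [h1 h2 h3 h4 h5]]] := block_choice parent_uniq unrooted_E
    sup_children weight_parents S (verts A k) (y_ k)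
    (divr_gt0 d0 (ltr0Sn R (size S))) (exprn_gt0 (W_ k) r0).
  by exists (n, phi).
pose sel' k S d := sel (k, S, d).
have sel'P k S d : 0 < d ->
    block_spec E lam W_ y_ k S d (sel' k S d).1 (sel' k S d).2.
  exact: (selP (k, S, d)).
pose g_ := gen E lam M N_ W_ y_ sel'.
have gens_HC d (s : 'I_d -> nat) (P : mpoly d R[i]) : injective s -> P != 0 ->
    mcoeff mnm0 P = 0 -> HC p (Bshift E lam) (peval P (fun j => g_ (s j))).
  move=> s_inj P0 Pc.
  exact: (HC_peval_gen p_ge1 parent_uniq unrooted_E csummable_B M_ge1 B_le
    N_gt0 W_gt0 y_out sel'P recurrent s_inj Pc P0).
have lp_poly : poly_image g_ `<=` lp p.
  move=> _ [n [P [Pc ->]]].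
  exact: (lp_peval_gen p_ge1 M_ge1 N_gt0 W_gt0 sel'P (@nat_of_ord n) Pc).
have zero_not_HC : ~ HC p (Bshift E lam) 0.
  exact: HC_neq0 (tree_nonempty tree_E).
have [hyper free] := hypercyclic_generated p_ge1 lp_poly zero_not_HC gens_HC.
exists (smallest (subalgebra p) (range g_)); split=> //.
move=> f fp e e0; have [_ [i _ <-] fi] :=
  gen_dense p_ge1 M_ge1 N_gt0 W_gt0 y_out sel'P recurrent fp e0.
by exists (g_ i) => //; apply: sub_gen_smallest; exists i.
Qed.
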